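(* Let $f:(0,\infty)^2\to(0,\infty)$ be a symmetric real function that is increasing in the variable $x$. Let $G$ be a connected graph and let $C$ be a cycle of $G$. Then there exists an edge $e$ on $C$ such that $\rho_f(G_e)\leq\rho_f(G)$.
   Context: All graphs are finite, simple and undirected. For a connected graph $G$ with vertices $v_1,\dots,v_n$ of degrees $d_1,\dots,d_n$, the $f$-adjacency matrix $A_f(G)$ has $(i,j)$-entry $f(d_i,d_j)$ if $v_iv_j\in E(G)$ and $0$ otherwise; $\rho_f(G)$ is the spectral radius of $A_f(G)$. For an edge $e=uv$ of $G$, $G_e$ is the graph obtained by subdividing $e$, i.e. deleting $e$ and adding a new vertex $w$ with edges $uw$ and $wv$. ''Increasing in the variable $x$'' means non-decreasing in $x$ for each fixed $y$. *)

(* Defs.v *)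
From HB Require Import structures.
From mathcomp Require Import all_boot all_order all_algebra.
From mathcomp Require Import boolp classical_sets reals.
From mathcomp Require Import complex.

Set Implicit Arguments.
Unset Strict Implicit.
Unset Printing Implicit Defensive.

Import Order.TTheory GRing.Theory Num.Theory.
Local Open Scope ring_scope.

Record sgraph := SGraph {
  vertex :> finType;
  adj : rel vertex;
  adj_sym : symmetric adj;
  adj_irrefl : irreflexive adj
}.

Definition degree (G : sgraph) (x : G) : nat := #|[set y : G | adj x y]|.

Definition connected_graph (G : sgraph) : Prop :=
  (0 < #|G|)%N /\ forall x y : G, connect (@adj G) x y.

(* A cycle is the cyclic sequence of its vertices, pairwise distinct and at
   least three in number. *)
Definition is_cycle (G : sgraph) (c : seq G) : bool :=
  (2 < size c)%N && ucycleb (@adj G) c.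

Definition cycle_edges (G : sgraph) (c : seq G) : {set {set G}} :=
  [set [set x; next c x]%SET | x in c]%SET.

(* The new vertex is None.  The definition is total in e, but is meaningful
   only when e is an edge of G, seen as the pair of its endpoints. *)
Definition subdivide_adj (G : sgraph) (e : {set G}) : rel (option G) :=
  fun a b =>
    match a, b with
    | Some x, Some y => adj x y && ([set x; y]%SET != e)
    | Some x, None | None, Some x => x \in e
    | None, None => false
    end.

Lemma subdivide_sym (G : sgraph) (e : {set G}) : symmetric (subdivide_adj e).
Proof. by move=> [x|] [y|] //=; rewrite adj_sym finset.setUC. Qed.

Lemma subdivide_irrefl (G : sgraph) (e : {set G}) :
  irreflexive (subdivide_adj e).
Proof. by move=> [x|] //=; rewrite adj_irrefl. Qed.

Definition subdivide (G : sgraph) (e : {set G}) : sgraph :=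
  SGraph (@subdivide_sym G e) (@subdivide_irrefl G e).

Definition f_adjacency (R : realType) (f : R -> R -> R) (G : sgraph) :
    'M[R]_#|G| :=
  \matrix_(i, j)
    (if adj (enum_val i) (enum_val j)
     then f (degree (enum_val i))%:R (degree (enum_val j))%:R
     else 0).

(* For 0 < n the set is finite and nonempty, so sup is a maximum; the modulus
   normc is valued in R, unlike `|z|, which lies in R[i]. *)
Definition spectral_radius (R : realType) (n : nat) (A : 'M[R]_n) : R :=
  sup [set ComplexField.Normc.normc z | z in [set z : R[i] |
         eigenvalue (map_mx (real_complex R) A) z]]%classic.

Definition f_spectral_radius (R : realType) (f : R -> R -> R) (G : sgraph) :
  R := spectral_radius (f_adjacency f G).

(* Main.v *)
(** Let [x > 0] be a Perron vector of [A_f(G)], let [u] minimize [x] on [C], and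
    let [v], [p] be the two neighbours of [u] on [C].  Subdivide [e = uv] and give
    the new vertex [w] the value [x_u].  Old degrees do not change and [w] has
    degree 2, at most any degree on [C], so by monotonicity of [f] no row sum at an
    old vertex increases.  At [w],
      f(2,d_u) x_u + f(2,d_v) x_v <= f(d_u,d_p) x_p + f(d_u,d_v) x_v <= rho x_u,
    the last step being the eigenvector equation at [u].  So the extended vector is
    a positive supersolution for [A_f(G_e)] at level [rho], which bounds every
    eigenvalue of [A_f(G_e)]. *)

Require Import Defs.
From mathcomp Require Import all_boot all_order all_algebra ring lra.
From mathcomp Require Import boolp classical_sets reals.
From mathcomp Require Import topology function_spaces normedtype derive complex.

Set Implicit Arguments.
Unset Strict Implicit.
Unset Printing Implicit Defensive.

Import Order.TTheory GRing.Theory Num.Theory.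
Import numFieldNormedType.Exports.
Local Open Scope ring_scope.

Local Notation normc := ComplexField.Normc.normc.

(** * Complex moduli and bounds on the spectral radius *)

Lemma normc_ge0 (R : rcfType) (z : R[i]) : 0 <= normc z.
Proof. by case: z => a b; exact: sqrtr_ge0. Qed.

Lemma normc_real (R : rcfType) (a : R) : normc a%:C%C = `|a|.
Proof. by rewrite /normc /= expr0n addr0 sqrtr_sqr. Qed.

Lemma normc_sum (R : rcfType) (I : finType) (F : I -> R[i]) :
  normc (\sum_i F i) <= \sum_i normc (F i).
Proof.
elim/big_ind2: _ => [|x1 x2 y1 y2 h1 h2|//].
  by rewrite ComplexField.Normc.normc0.
by apply: le_trans (le_normcD _ _) _; exact: lerD.
Qed.

(* Pair the moduli of a left eigenvector with the positive supersolution [y]. *)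
Lemma eigenvalue_normc_le (R : realType) (n : nat) (A : 'M[R]_n)
    (y : 'I_n -> R) (r : R) (z : R[i]) :
  (forall i j, 0 <= A i j) -> (forall i, 0 < y i) ->
  (forall i, \sum_j A i j * y j <= r * y i) ->
  eigenvalue (map_mx (real_complex R) A) z -> normc z <= r.
Proof.
move=> A_ge0 y_gt0 Ay /eigenvalueP[v vA v_neq0].
have yv_gt0 : 0 < \sum_i normc (v 0 i) * y i.
  have [i vi_neq0] := rV0Pn _ v_neq0.
  have yv_ge0 j : 0 <= normc (v 0 j) * y j by rewrite mulr_ge0 ?normc_ge0 ?ltW.
  rewrite (bigD1 i) //= ltr_pwDl ?sumr_ge0// mulr_gt0// lt_def normc_ge0 andbT.
  by apply: contra vi_neq0 => /eqP/ComplexField.Normc.eq0_normc ->.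
rewrite -(ler_pM2r yv_gt0) mulr_sumr.
(* By the triangle inequality, coordinate [j] of [v A = z v] has modulus at most
   [\sum_i normc (v 0 i) * A i j]. Exchanging the two sums then exposes the row sums of [A] against
   [y]. *)
apply: (@le_trans _ _ (\sum_j (\sum_i normc (v 0 i) * A i j) * y j)).
  apply: ler_sum => j _; rewrite mulrA; apply: ler_wpM2r; first exact: ltW.
  rewrite -ComplexField.Normc.normcM.
  have -> : z * v 0 j = \sum_i v 0 i * (A i j)%:C%C.
    by move/rowP/(_ j): vA; rewrite !mxE => <-; apply: eq_bigr => i _; rewrite mxE.
  apply: le_trans (normc_sum _) _; apply: ler_sum => i _.
  by rewrite ComplexField.Normc.normcM normc_real ger0_norm.
under eq_bigr do rewrite mulr_suml.
rewrite exchange_big mulr_sumr /=; apply: ler_sum => i _.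
under eq_bigr do rewrite -mulrA.
by rewrite -mulr_sumr mulrCA ler_wpM2l ?normc_ge0.
Qed.

Lemma spectral_radius_le (R : realType) (n : nat) (A : 'M[R]_n)
    (y : 'I_n -> R) (r : R) :
  0 <= r -> (forall i j, 0 <= A i j) -> (forall i, 0 < y i) ->
  (forall i, \sum_j A i j * y j <= r * y i) -> spectral_radius A <= r.
Proof.
move=> r_ge0 A_ge0 y_gt0 Ay; rewrite /spectral_radius.
(* An empty set of eigenvalues has [sup] equal to 0 by default; this is where [0 <= r] enters. *)
have [->|] := eqVneq [set normc z | z in [set z : R[i] |
    eigenvalue (map_mx (real_complex R) A) z]]%classic set0; first by rewrite sup0.
move=> /set0P S_neq0; apply: ge_sup => // _ [z zA <-].
exact: eigenvalue_normc_le zA.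
Qed.

(** A positive eigenvector is its own supersolution, so [mu] bounds every eigenvalue in modulus;
    [mu] is also attained, the same vector being an eigenvector over the complex numbers. *)
Lemma spectral_radius_eigenvector (R : realType) (n : nat) (A : 'M[R]_n)
    (x : 'rV[R]_n) (mu : R) : (0 < n)%N ->
  A^T = A -> (forall i j, 0 <= A i j) -> (forall i, 0 < x 0 i) ->
  x *m A = mu *: x -> spectral_radius A = mu.
Proof.
move=> n_gt0 A_sym A_ge0 x_gt0 xA; pose i0 := Ordinal n_gt0.
have Ax i : \sum_j A i j * x 0 j = mu * x 0 i.
  move/rowP/(_ i): xA; rewrite !mxE => <-; apply: eq_bigr => j _.
  by rewrite -[in LHS]A_sym mxE mulrC.
have mu_ge0 : 0 <= mu.
  rewrite -(pmulr_lge0 _ (x_gt0 i0)) -Ax sumr_ge0// => j _.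
  by rewrite mulr_ge0 ?A_ge0 ?ltW.
have Ax_le i : \sum_j A i j * x 0 j <= mu * x 0 i by rewrite Ax.
apply/eqP; rewrite eq_le (spectral_radius_le mu_ge0 A_ge0 x_gt0 Ax_le) /=.
apply: ub_le_sup.
  exists mu => _ [z zA <-]; exact: (eigenvalue_normc_le A_ge0 x_gt0 Ax_le zA).
exists mu%:C%C; last by rewrite normc_real ger0_norm.
apply/eigenvalueP; exists (map_mx (real_complex R) x).
  by rewrite -map_mxM xA map_mxZ.
apply: contraTneq (x_gt0 i0) => /rowP/(_ i0).
by rewrite !mxE => -[->]; rewrite ltxx.
Qed.

(** * Quadratic forms, Rayleigh quotients and the Perron vector *)

Lemma continuous_sum (R : realType) (T : topologicalType) (I : finType)
    (F : I -> T -> R) :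
  (forall i, continuous (F i)) -> continuous (fun x => \sum_i F i x).
Proof.
move=> F_cont; apply: (continuous_big (op := +%R)) => [|i _ //].
exact: add_continuous.
Qed.

Section QuadraticForm.
Variables (R : realType) (n : nat).
Implicit Types (B : 'M[R]_n) (x : 'rV[R]_n).

Definition quad_form B x : R := (x *m B *m x^T) 0 0.

Lemma quad_formE B x : quad_form B x = \sum_i \sum_j x 0 i * x 0 j * B i j.
Proof.
rewrite /quad_form -mulmxA mxE; apply: eq_bigr => i _; rewrite mxE mulr_sumr.
by apply: eq_bigr => j _; rewrite mxE; ring.
Qed.

Lemma quad_form1 x : quad_form 1%:M x = \sum_i x 0 i ^+ 2.
Proof. by rewrite /quad_form mulmx1 mxE; apply: eq_bigr => i _; rewrite mxE expr2. Qed.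

Lemma quad_form_continuous B : continuous (quad_form B).
Proof.
have -> : quad_form B = fun x => \sum_i \sum_j x 0 i * x 0 j * B i j.
  by apply/funext => x; exact: quad_formE.
apply: continuous_sum => i; apply: continuous_sum => j.
have coord k : continuous (fun x : 'rV[R]_n => x 0 k) by exact: coord_continuous.
move=> x; exact: cvgM (cvgM (coord i x) (coord j x)) (cvg_cst (B i j)).
Qed.

Lemma quad_formZ B a x : quad_form B (a *: x) = a ^+ 2 * quad_form B x.
Proof.
rewrite /quad_form linearZ /= -scalemxAl -!scalemxAr -scalemxAl scalerA !mxE.
by rewrite expr2.
Qed.

Lemma quad_form0 B : quad_form B 0 = 0.
Proof. by rewrite /quad_form !mul0mx mxE. Qed.

(** Symmetry of [B] merges the two cross terms into the factor 2. The expansion supplies the first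
    variation at a Rayleigh maximum. *)
Lemma quad_formD_delta B x i t : B^T = B ->
  quad_form B (x + t *: delta_mx 0 i) =
    quad_form B x + (2 * t * (x *m B) 0 i + t ^+ 2 * B i i).
Proof.
move=> B_sym; rewrite /quad_form.
have e1 : ((delta_mx 0 i : 'rV_n) *m B *m x^T) 0 0 = (x *m B) 0 i.
  rewrite -rowE !mxE; apply: eq_bigr => j _.
  by rewrite !mxE -[in LHS]B_sym mxE mulrC.
have e2 : (x *m B *m (delta_mx i 0 : 'cV_n)) 0 0 = (x *m B) 0 i by rewrite -colE mxE.
have e3 : ((delta_mx 0 i : 'rV_n) *m B *m (delta_mx i 0 : 'cV_n)) 0 0 = B i i.
  by rewrite -colE -rowE !mxE.
have entryD (M N : 'M[R]_1) : (M + N) 0 0 = M 0 0 + N 0 0 by rewrite mxE.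
have entryZ a (M : 'M[R]_1) : (a *: M) 0 0 = a * M 0 0 by rewrite mxE.
rewrite linearD linearZ /= trmx_delta !mulmxDl !mulmxDr -!scalemxAl -!scalemxAr.
by rewrite !(entryD, entryZ) e1 e2 e3; ring.
Qed.
End QuadraticForm.


(** The nonnegative part of the unit sphere is compact, so the form attains a maximum there;
    homogeneity of degree 2 carries the bound to all nonnegative [z]. *)
Lemma rayleigh_max (R : realType) (n : nat) (A : 'M[R]_n) : (0 < n)%N ->
  exists2 x : 'rV[R]_n, (forall i, 0 <= x 0 i) /\ quad_form 1%:M x = 1 &
    forall z : 'rV[R]_n, (forall i, 0 <= z 0 i) ->
      quad_form A z <= quad_form A x * quad_form 1%:M z.
Proof.
move=> n_gt0; pose i0 := Ordinal n_gt0.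
(* A nonnegative unit vector has coordinates at most 1, so the cube cuts nothing off and gives
   compactness as a product of segments. *)
pose cube := [set v : 'rV[R]_n | forall i, `[0, 1]%classic (v 0 i)]%classic.
pose S := (cube `&` quad_form 1%:M @^-1` [set 1])%classic.
have S_in (z : 'rV[R]_n) : (forall i, 0 <= z 0 i) -> quad_form 1%:M z = 1 -> S z.
  move=> z_ge0 z1; split=> // i /=; rewrite in_itv /= z_ge0 /=.
  rewrite -(@expr_le1 _ 2)// -z1 quad_form1 (bigD1 i) //= lerDl.
  by apply: sumr_ge0 => j _; exact: sqr_ge0.
have S_neq0 : (S !=set0)%classic.
  exists (delta_mx 0 i0); apply: S_in => [i|]; first by rewrite mxE ler0n.
  rewrite quad_form1 (bigD1 i0) //= mxE !eqxx expr1n big1 ?addr0// => j ji.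
  by rewrite mxE (negPf ji) andbF expr0n.
have S_compact : compact S.
  apply: compact_closedI.
    have := @rV_compact R n (fun=> `[0, 1]%classic).
    by apply=> i; exact: segment_compact.
  apply: (@preimage_closed _ _ (quad_form 1%:M)); last exact: closed_eq.
  by move=> x _; exact: quad_form_continuous.
have [x] := EVT_max_rV S_neq0 S_compact
  (continuous_subspaceT (@quad_form_continuous _ _ A)).
rewrite inE => -[x01 x1] x_max; exists x.
  by split=> // i; have := x01 i; rewrite /= in_itv /= => /andP[].
move=> z z_ge0; have [z0|z_neq0] := eqVneq (quad_form 1%:M z) 0.
  have -> : z = 0.
    apply/rowP => i; rewrite mxE; apply/eqP; rewrite -sqrf_eq0; apply/eqP.
    move: z0; rewrite quad_form1 => /psumr_eq0P; apply=> // j _.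
    exact: sqr_ge0.
  by rewrite !quad_form0 mulr0.
have z_gt0 : 0 < quad_form 1%:M z.
  rewrite lt_def z_neq0 quad_form1; apply: sumr_ge0 => i _; exact: sqr_ge0.
set N := quad_form 1%:M z in z_gt0 *.
rewrite -ler_pdivrMr// mulrC.
have -> : N^-1 * quad_form A z = quad_form A ((Num.sqrt N)^-1 *: z).
  by rewrite quad_formZ exprVn sqr_sqrtr ?ltW.
apply: x_max; rewrite inE; apply: S_in => [i|].
  by rewrite mxE mulr_ge0 ?invr_ge0 ?sqrtr_ge0.
by rewrite quad_formZ exprVn sqr_sqrtr ?ltW// mulVf// gt_eqF.
Qed.

(* At a maximum [x] of the Rayleigh quotient over nonnegative vectors, the first
   variation along each basis vector gives [x A <= mu x]; pairing with [x]
   forces equality. *)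
Lemma symmetric_perron_vector (R : realType) (n : nat) (A : 'M[R]_n) :
  (0 < n)%N -> A^T = A -> (forall i j, 0 <= A i j) ->
  (forall i j, connect (fun i j => 0 < A i j) i j) ->
  exists2 x : 'rV[R]_n, (forall i, 0 < x 0 i) &
    exists mu, x *m A = mu *: x.
Proof.
move=> n_gt0 A_sym A_ge0 A_irr.
have [x [x_ge0 x1] x_max] := rayleigh_max A n_gt0.
set mu := quad_form A x in x_max.
have xA_ge0 i : 0 <= (x *m A) 0 i.
  by rewrite mxE sumr_ge0 // => j _; rewrite mulr_ge0.
have xA_le i : (x *m A) 0 i <= mu * x 0 i.
  rewrite leNgt; apply/negP => lt_mu; set d := (x *m A) 0 i - mu * x 0 i.
  have d_gt0 : 0 < d by rewrite subr_gt0.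
  have mu_ge0 : 0 <= mu.
    rewrite /mu quad_formE; apply: sumr_ge0 => j _; apply: sumr_ge0 => k _.
    by rewrite !mulr_ge0.
  (* Maximality against [x + t *: delta_mx 0 i] reads [2 * t * d + t ^+ 2 * A i i <= mu * t ^+ 2].
     This [t] makes [d = t * (mu + 1)], so the left side is too large; adding 1 keeps the
     denominator positive when [mu = 0]. *)
  pose t := d / (mu + 1).
  have t_gt0 : 0 < t by rewrite divr_gt0// ltr_wpDl.
  have t_eq : t * (mu + 1) = d by rewrite divfK// gt_eqF// ltr_wpDl.
  have /x_max : forall j, 0 <= (x + t *: delta_mx 0 i) 0 j.
    by move=> j; rewrite !mxE addr_ge0// mulr_ge0 ?ler0n// ltW.
  have id_ii : (1%:M : 'M[R]_n) i i = 1 by rewrite mxE eqxx.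
  rewrite !quad_formD_delta// ?trmx1// -/mu x1 mulmx1 id_ii.
  have t2_gt0 : 0 < t ^+ 2 by rewrite exprn_gt0.
  have gE : (x *m A) 0 i = t * (mu + 1) + mu * x 0 i by rewrite t_eq subrK.
  rewrite gE; have := mulr_ge0 (ltW t2_gt0) (A_ge0 i i).
  have := mulr_ge0 (ltW t2_gt0) mu_ge0.
  by nra.
have xA_eq i : (x *m A) 0 i = mu * x 0 i.
  have slack_ge0 j : 0 <= x 0 j * (mu * x 0 j - (x *m A) 0 j).
    by rewrite mulr_ge0// subr_ge0.
  have /psumr_eq0P/(_ i isT) : \sum_j x 0 j * (mu * x 0 j - (x *m A) 0 j) = 0.
    under eq_bigr do rewrite mulrBr mulrCA -expr2.
    rewrite sumrB -mulr_sumr -quad_form1 x1 mulr1 /mu /quad_form mxE.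
    apply/eqP; rewrite subr_eq0; apply/eqP; apply: eq_bigr => j _.
    by rewrite [x^T _ _]mxE mulrC.
  move=> /(_ (fun j _ => slack_ge0 j))/eqP; rewrite mulf_eq0 subr_eq0.
  (* Where [x 0 i = 0] the vanishing product says nothing about the slack, but [xA_ge0] and [xA_le]
     squeeze [(x *m A) 0 i] to 0. *)
  case/orP => /eqP // xi0; apply/le_anti; rewrite xA_le /=.
  by rewrite xi0 mulr0.
exists x; last by exists mu; apply/rowP => i; rewrite xA_eq mxE.
(* Zeros of [x] spread along positive entries, so by irreducibility a single zero would give
   [x = 0], against its unit norm. *)
have zero_step i j : 0 < A i j -> x 0 i = 0 -> x 0 j = 0.
  move=> Aij xi0; have := xA_eq i; rewrite xi0 mulr0 mxE => /psumr_eq0P.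
  have Aji : 0 < A j i by rewrite -A_sym mxE.
  move=> /(_ (fun k _ => mulr_ge0 (x_ge0 k) (A_ge0 k i)))/(_ j isT)/eqP.
  by rewrite mulf_eq0 (gt_eqF Aji) orbF => /eqP.
move=> i; rewrite lt_def x_ge0 andbT; apply/eqP => xi0.
have x0 j : x 0 j = 0.
  have [p] := connectP (A_irr i j); elim: p i xi0 => [|k p IH] i xi0 /=.
    by move=> _ ->.
  by case/andP => Aik; apply: IH; exact: zero_step xi0.
by move: x1; rewrite quad_form1 big1 => [/esym/eqP|j _]; rewrite ?oner_eq0// x0 expr0n.
Qed.

(** * Degrees and neighbours on a cycle *)

Section Degree.
Variable G : sgraph.

Lemma adj_degree_gt0 (x y : G) : adj x y -> (0 < degree x)%N.
Proof. by move=> xy; apply/card_gt0P; exists y; rewrite inE. Qed.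

Lemma is_cycle_neighbors (C : seq G) (x : G) : is_cycle C -> x \in C ->
  [/\ adj x (next C x), adj x (prev C x) & next C x != prev C x].
Proof.
case/andP=> C_gt2 /andP[C_cycle C_uniq] xC; split.
- exact: next_cycle.
- by rewrite adj_sym; exact: prev_cycle.
(* If both neighbours coincided, two steps along the cycle would return to [x]; with [x] rotated to
   the head, this contradicts having three distinct vertices. *)
apply/eqP => np; have [i s rotE] := rot_to xC.
have : next C (next C x) = x by rewrite np next_prev.
rewrite -!(next_rot i C_uniq) rotE.
have : uniq (x :: s) by rewrite -rotE rot_uniq.
have : (2 < size (x :: s))%N by rewrite -rotE size_rot.
case: s {rotE} => [|a [|b s]] //= _ /andP[]; rewrite !inE !negb_or.
case/and3P=> xa xb _ _; rewrite eqxx eq_sym (negPf xa) eqxx => bx.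
by rewrite bx eqxx in xb.
Qed.

Lemma is_cycle_degree_ge2 (C : seq G) (x : G) :
  is_cycle C -> x \in C -> (2 <= degree x)%N.
Proof.
move=> C_cycle /(is_cycle_neighbors C_cycle)[xn xp np].
by apply/card_gt1P; exists (next C x), (prev C x); rewrite !inE.
Qed.
End Degree.

(** * Neighbourhoods and degrees after subdividing an edge *)

Section Subdivision.
Variables (G : sgraph) (u v : G).
Hypothesis uv : adj u v.
Let e : {set G} := [set u; v].

(* The neighbour of [Some x] in the subdivision that replaces [w]. *)
Definition subdivide_neighbor (x w : G) : subdivide e :=
  if [set x; w] == e then None else Some w.

(** Two neighbours can only collide at [None], and then both complete [x] to [e]; since there are no
    loops, [x] and [e] determine the other endpoint. *)
Lemma subdivide_neighbor_inj (x : G) :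
  {in [set w | adj x w] &, injective (subdivide_neighbor x)}.
Proof.
move=> w w'; rewrite !inE /subdivide_neighbor => xw xw'.
case: eqP => [<-|_]; case: eqP => [ww'|_] //; last by case.
move: (set22 x w); rewrite -ww' !inE => /orP[]/eqP // wx.
by rewrite wx adj_irrefl in xw.
Qed.

(** Presenting the new neighbourhood as an injective image of the old one gives both the invariance
    of old degrees and the reindexing of row sums. *)
Lemma subdivide_neighborhood (x : G) :
  [set b : subdivide e | adj (Some x : subdivide e) b] =
  subdivide_neighbor x @: [set w | adj x w].
Proof.
apply/setP => -[w|]; rewrite inE /=; apply/idP/imsetP.
- by case/andP => xw /negPf xwe; exists w; rewrite ?inE// /subdivide_neighbor xwe.
- case=> w'; rewrite inE /subdivide_neighbor => xw'.
  by case: ifPn => // xwe [->]; rewrite xw'.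
- rewrite !inE => /orP[]/eqP->.
    by exists v; rewrite ?inE// /subdivide_neighbor eqxx.
  by exists u; rewrite ?inE 1?adj_sym// /subdivide_neighbor finset.setUC eqxx.
- case=> w _; rewrite /subdivide_neighbor; case: eqP => // <- _.
  by rewrite !inE eqxx.
Qed.

Lemma subdivide_neighborhood_None :
  [set b : subdivide e | adj (None : subdivide e) b] = [set Some u; Some v].
Proof. by apply/setP => -[w|]; rewrite !inE //= !inE. Qed.

Lemma degree_subdivide (x : G) : degree (Some x : subdivide e) = degree x.
Proof.
by rewrite /degree subdivide_neighborhood card_in_imset//; exact: subdivide_neighbor_inj.
Qed.

Lemma degree_subdivide_None : degree (None : subdivide e) = 2%N.
Proof.
rewrite /degree subdivide_neighborhood_None cards2.
by case: eqP => // -[uE]; move: uv; rewrite uE adj_irrefl.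
Qed.
End Subdivision.

(** * The matrix results transferred to weighted sums over neighbourhoods *)

Section FAdjacency.
Variables (R : realType) (f : R -> R -> R).
Hypothesis f_pos : forall x y : R, 0 < x -> 0 < y -> 0 < f x y.
Hypothesis f_sym : forall x y : R, 0 < x -> 0 < y -> f x y = f y x.

Definition edge_weight (G : sgraph) (x y : G) : R := f (degree x)%:R (degree y)%:R.

Lemma edge_weight_gt0 (G : sgraph) (x y : G) : adj x y -> 0 < edge_weight x y.
Proof.
move=> xy; have yx : adj y x by rewrite adj_sym.
by apply: f_pos; rewrite ltr0n; [exact: adj_degree_gt0 xy|exact: adj_degree_gt0 yx].
Qed.

Lemma f_adjacencyE (G : sgraph) i j : f_adjacency f G i j =
  if adj (enum_val i) (enum_val j)
  then edge_weight (enum_val i) (enum_val j) else 0.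
Proof. by rewrite mxE. Qed.

Lemma f_adjacency_ge0 (G : sgraph) i j : 0 <= f_adjacency f G i j.
Proof. by rewrite f_adjacencyE; case: ifP => // /edge_weight_gt0/ltW. Qed.

Lemma f_adjacency_sym (G : sgraph) : (f_adjacency f G)^T = f_adjacency f G.
Proof.
apply/matrixP => i j; rewrite mxE !f_adjacencyE adj_sym; case: ifP => // ij.
have ji : adj (enum_val j) (enum_val i) by rewrite adj_sym.
by apply: f_sym; rewrite ltr0n; [exact: adj_degree_gt0 ji|exact: adj_degree_gt0 ij].
Qed.

Lemma f_adjacency_sum (G : sgraph) (y : G -> R) i :
  \sum_j f_adjacency f G i j * y (enum_val j) =
  \sum_(w in [set w | adj (enum_val i) w]) edge_weight (enum_val i) w * y w.
Proof.
pose F w := (if adj (enum_val i) w then edge_weight (enum_val i) w else 0) * y w.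
transitivity (\sum_(j < #|G|) F (enum_val j)).
  by apply: eq_bigr => j _; rewrite f_adjacencyE.
rewrite -big_enum_val [RHS]big_mkcond /=; apply: eq_bigr => w _.
by rewrite inE /F; case: ifP => // _; rewrite mul0r.
Qed.

Lemma f_spectral_radius_le (G : sgraph) (y : G -> R) (r : R) :
  0 <= r -> (forall x, 0 < y x) ->
  (forall x, \sum_(w in [set w | adj x w]) edge_weight x w * y w <= r * y x) ->
  f_spectral_radius f G <= r.
Proof.
move=> r_ge0 y_gt0 Ay.
apply: (@spectral_radius_le _ _ _ (fun i => y (enum_val i))) => // [|i].
  exact: f_adjacency_ge0.
by rewrite f_adjacency_sum.
Qed.

(** Entries on edges are positive, so paths of [G] make the matrix irreducible; positivity of the
    eigenvector then identifies its eigenvalue with the spectral radius. *)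
Lemma f_perron_vector (G : sgraph) : connected_graph G ->
  exists2 y : G -> R, (forall x, 0 < y x) &
    forall x, \sum_(w in [set w | adj x w]) edge_weight x w * y w =
      f_spectral_radius f G * y x.
Proof.
case=> G_gt0 G_conn.
have A_irr (i j : 'I_#|G|) : connect (fun i j => 0 < f_adjacency f G i j) i j.
  have [p] := connectP (G_conn (enum_val i) (enum_val j)).
  elim: p i => [|x p IH] i /=; first by move=> _ /enum_val_inj ->; exact: connect0.
  case/andP => ix xp jE; apply: (@connect_trans _ _ (enum_rank x)); last first.
    by apply: IH; rewrite enum_rankK.
  by apply: connect1; rewrite f_adjacencyE enum_rankK ix edge_weight_gt0.
have [x x_gt0 [mu xA]] :=
  symmetric_perron_vector G_gt0 (f_adjacency_sym G) (@f_adjacency_ge0 G) A_irr.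
have muE : f_spectral_radius f G = mu.
  exact: (spectral_radius_eigenvector G_gt0 (f_adjacency_sym G) (@f_adjacency_ge0 G)
    x_gt0 xA).
exists (fun w => x 0 (enum_rank w)) => // w.
rewrite -(enum_rankK w) -f_adjacency_sum muE enum_valK.
move/rowP/(_ (enum_rank w)): xA; rewrite !mxE => <-; apply: eq_bigr => j _.
by rewrite enum_valK -[in LHS]f_adjacency_sym mxE mulrC.
Qed.
End FAdjacency.

(** * Choice of the edge and comparison row by row *)

Theorem theorem3p2 (R : realType) (f : R -> R -> R)
  (f_pos : forall x y : R, 0 < x -> 0 < y -> 0 < f x y)
  (f_sym : forall x y : R, 0 < x -> 0 < y -> f x y = f y x)
  (f_incr : forall x x' y : R, 0 < x -> 0 < y -> x <= x' -> f x y <= f x' y)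
  (G : sgraph) (G_conn : connected_graph G)
  (C : seq G) (C_cycle : is_cycle C) :
  exists2 e : {set G}, e \in cycle_edges C &
    f_spectral_radius f (subdivide e) <= f_spectral_radius f G.
Proof.
have [y y_gt0 Ay] := f_perron_vector f_pos f_sym G_conn.
set rho := f_spectral_radius f G in Ay *.
have [u0 u0C] : exists u0, u0 \in C.
  by case: C C_cycle => // u0 C' _; exists u0; exact: mem_head.
have [u uC y_min] : exists2 u, u \in C & forall w, w \in C -> y u <= y w.
  by case: (arg_minP y u0C) => u uC y_min; exists u.
have [un up np] := is_cycle_neighbors C_cycle uC.
set v := next C u in un np; set p := prev C u in up np.
have vC : v \in C by rewrite mem_next.
have pC : p \in C by rewrite mem_prev.
have deg_ge2 w : w \in C -> 2 <= (degree w)%:R :> R.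
  by move=> wC; rewrite ler_nat; exact: is_cycle_degree_ge2 wC.
have deg_gt0 w : w \in C -> 0 < (degree w)%:R :> R.
  by move/deg_ge2; apply: lt_le_trans.
have f_incr_r x x' z : 0 < x -> 0 < z -> x <= x' -> f z x <= f z x'.
  by move=> x0 z0 xx'; rewrite (f_sym z x)// (f_sym z x') ?(lt_le_trans x0 xx')// f_incr.
have term_ge0 x w : w \in [set w | adj x w] -> 0 <= edge_weight f x w * y w.
  by rewrite inE => xw; rewrite mulr_ge0 ?ltW// edge_weight_gt0.
exists [set u; v]; first by apply/imsetP; exists u.
pose y' (b : subdivide [set u; v]) : R := if b is Some w then y w else y u.
apply: (@f_spectral_radius_le _ _ f_pos _ y').
- rewrite -(pmulr_lge0 _ (y_gt0 u)) -Ay; exact: sumr_ge0 (term_ge0 u).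
- by case=> [w|]; exact: y_gt0.
case=> [x|].
  rewrite subdivide_neighborhood// big_imset /=; last exact: subdivide_neighbor_inj.
  rewrite -Ay; apply: ler_sum => w; rewrite inE => xw.
  rewrite /edge_weight degree_subdivide// /subdivide_neighbor.
  (* Only the term of [e] changes: the endpoint [w] gives way to the new vertex. Since [w] lies on
     [C], both its degree and its value [y w] are at least the new ones, [2] and [y u]. *)
  case: eqP => [xwE|_]; last by rewrite degree_subdivide.
  rewrite degree_subdivide_None//=.
  have wC : w \in C.
    by have := set22 x w; rewrite xwE !inE => /orP[]/eqP ->.
  have x_gt0 : 0 < (degree x)%:R :> R by rewrite ltr0n; exact: adj_degree_gt0 xw.
  apply: ler_pM; [exact/ltW/f_pos|exact: ltW| |exact: y_min].
  by apply: f_incr_r => //; exact: deg_ge2.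
rewrite subdivide_neighborhood_None// big_setU1 ?big_set1/=; last first.
  by rewrite inE; apply: contraTneq un => -[->]; rewrite adj_irrefl.
rewrite -Ay /edge_weight !degree_subdivide// degree_subdivide_None//.
(* The distinct neighbours [v] and [p] are split off the sum at [u]. The new term at [v] is compared
   with the old one at [v], raising 2 to the degree of [u]; the new term at [u] with the old one at
   [p], raising 2 to the degree of [p]. *)
rewrite (bigD1 v) ?inE//= (bigD1 p) ?inE ?up 1?eq_sym//= addrA addrC.
rewrite -[leLHS]addr0; apply: lerD; last first.
  by apply: sumr_ge0 => w /andP[/andP[uw _] _]; exact: term_ge0.
apply: lerD.
  by apply: ler_wpM2r; [exact: ltW|apply: f_incr; rewrite ?deg_gt0 ?deg_ge2].
rewrite f_sym ?deg_gt0//; apply: ler_pM; [|exact: ltW| |exact: y_min].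
  by rewrite ltW// f_pos// deg_gt0.
by apply: f_incr_r; rewrite ?deg_gt0 ?deg_ge2.
Qed.
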